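(* Let $n$ and $k\geq 2$ be positive integers, let $P=(p_1,\dots,p_k)$ be a probability distribution on $\{1,\dots,k\}$, let $X=(X_1,\dots,X_k)$ be multinomially distributed with $n$ samples and probabilities $P$, and let $V_{n,k,P}=D\big((X_1/n,\dots,X_k/n)\,\|\,(p_1,\dots,p_k)\big)$. Then for all real $0\leq t<n$, \[ \mathbb{E}\big[\exp(t\cdot V_{n,k,P})\big]\leq\left(\frac{1}{1-t/n}\right)^{k-1}. \]
   Context: For probability distributions $(q_1,\dots,q_k)$ and $(p_1,\dots,p_k)$ on a finite set, the Kullback--Leibler divergence is $D\big((q_1,\dots,q_k)\,\|\,(p_1,\dots,p_k)\big)=\sum_{i=1}^k q_i\log\frac{q_i}{p_i}$, with natural logarithm and the usual conventions $0\log(0/p)=0$. *)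

(* Defs.v *)
From HB Require Import structures.
From mathcomp Require Import all_boot all_order all_algebra.
From mathcomp Require Import reals ereal sequences exp.
Set Implicit Arguments. Unset Strict Implicit. Unset Printing Implicit Defensive.
Import Order.TTheory GRing.Theory Num.Theory.
Local Open Scope ring_scope.

Definition KL (R : realType) (k : nat) (q p : 'I_k -> R) : R :=
  \sum_(i < k) (if q i == 0 then 0 else q i * ln (q i / p i)).

Definition is_prob_vec (R : realType) (k : nat) (p : 'I_k -> R) : Prop :=
  (forall i, 0 <= p i) /\ \sum_(i < k) p i = 1.

Definition multinomial_pmf (R : realType) (n k : nat) (p : 'I_k -> R)
  (x : 'I_k -> nat) : R :=
  (n`!)%:R / (\prod_(i < k) ((x i)`!)%:R) * \prod_(i < k) p i ^+ x i.

Definition multinomial_expect (R : realType) (n k : nat) (p : 'I_k -> R)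
  (F : ('I_k -> nat) -> R) : R :=
  \sum_(x : {ffun 'I_k -> 'I_n.+1} | (\sum_(i < k) (x i : nat) == n)%N)
     multinomial_pmf n p (fun i => x i : nat) * F (fun i => x i : nat).

Definition V_stat (R : realType) (n k : nat) (p : 'I_k -> R)
  (x : 'I_k -> nat) : R :=
  KL (fun i => (x i)%:R / n%:R) p.

(* Main.v *)
(** Put [s = t / n].  The weighted AM-GM inequality
    [p_i^(1-s) (x_i/n)^s <= (1-s) p_i + s x_i/n] bounds the moment generating
    function by
    [n! / n^n * \sum_x \prod_i ((1-s) n p_i + s x_i)^(x_i) / x_i!],
    which an Abel-type identity evaluates exactly as
    [\sum_(j <= n) 'C(j + k - 2, j) s^j n^_j / n^j].
    As [n^_j <= n^j], this is at most a partial sum of the binomial series of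
    [(1 - s)^-(k - 1)]. *)
Require Import Defs.
From HB Require Import structures.
From mathcomp Require Import all_boot all_order all_algebra.
From mathcomp Require Import reals ereal sequences exp.
From mathcomp Require Import ring lra zify.
Set Implicit Arguments. Unset Strict Implicit. Unset Printing Implicit Defensive.
Import Order.TTheory GRing.Theory Num.Theory.
Local Open Scope ring_scope.

Lemma sum_triangle (V : nmodType) (n : nat) (F : nat -> nat -> V) :
  \sum_(i < n.+1) \sum_(j < i.+1) F j (i - j)%N =
  \sum_(j < n.+1) \sum_(l < (n - j).+1) F j l.
Proof.
elim: n => [|n IH]; first by rewrite !big_ord_recl !big_ord0.
rewrite big_ord_recr /= {}IH [in RHS]big_ord_recr /= subnn big_ord1.
rewrite [X in _ + X]big_ord_recr /= subnn addrA -big_split /=; congr (_ + _).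
by apply: eq_bigr => j _; rewrite subSn -1?ltnS // [in RHS]big_ord_recr.
Qed.

Lemma sum_triangle_exchange (V : nmodType) (n : nat) (F : nat -> nat -> V) :
  \sum_(i < n.+1) \sum_(j < (n - i).+1) F i j =
  \sum_(j < n.+1) \sum_(i < (n - j).+1) F i j.
Proof.
rewrite -sum_triangle -(sum_triangle n (fun i j => F j i)); apply: eq_bigr => i _.
rewrite (reindex_inj rev_ord_inj); apply: eq_bigr => j _ /=.
by rewrite subSS subKn // -ltnS.
Qed.

Lemma finite_difference (A : comNzRingType) (m p : nat) (a s : A) :
  (p <= m)%N ->
  \sum_(x < m.+1) (-1) ^+ (m - x) * 'C(m, x)%:R * (a + s * x%:R) ^+ p =
  if p == m then s ^+ m * m`!%:R else 0.
Proof.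
elim: m p => [|m IH] p.
  by rewrite leqn0 => /eqP->; rewrite big_ord1 bin0 !expr0 !mulr1.
move=> le_pm.
(* Pascal's rule: the difference of order [m.+1] is that of order [m] applied to
   [(X + s) ^+ p - X ^+ p]. *)
have -> : \sum_(x < m.+2) (-1) ^+ (m.+1 - x) * 'C(m.+1, x)%:R *
      (a + s * x%:R) ^+ p =
    \sum_(x < m.+1) (-1) ^+ (m - x) * 'C(m, x)%:R *
      (((a + s * x%:R) + s) ^+ p - (a + s * x%:R) ^+ p).
  have -> : \sum_(x < m.+1) (-1) ^+ (m - x) * 'C(m, x)%:R *
      (((a + s * x%:R) + s) ^+ p - (a + s * x%:R) ^+ p) =
      \sum_(x < m.+1) (-1) ^+ (m - x) * 'C(m, x)%:R *
         (a + s * x.+1%:R) ^+ p +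
      \sum_(x < m.+2) (-1) ^+ (m.+1 - x) * 'C(m, x)%:R *
         (a + s * x%:R) ^+ p.
    rewrite [X in _ + X]big_ord_recr /= bin_small // mulr0 mul0r addr0.
    rewrite -big_split; apply: eq_bigr => x _ /=.
    rewrite subSn -1?ltnS // exprS -[x.+1%:R]natr1 [s * (_ + 1)]mulrDr mulr1 addrA; ring.
  rewrite big_ord_recl [in X in _ = _ + X]big_ord_recl /= !bin0 addrCA; congr (_ + _).
  rewrite -big_split; apply: eq_bigr => x _ /=.
  by rewrite /bump /= add1n binS natrD subSS; ring.
under eq_bigr => x _.
  rewrite [_ + s]addrC (exprDn s) big_ord_recr /= subnn expr0 mul1r binn mulr1n addrK mulr_sumr.
  over.
rewrite exchange_big /=.
(* By induction only [i = m] contributes, and [i < p <= m.+1] allows it only when [p = m.+1]. *)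
transitivity (\sum_(i < p) s ^+ (p - i) * 'C(p, i)%:R *
    (if (i : nat) == m then s ^+ m * m`!%:R else 0)).
  apply: eq_bigr => i _; rewrite -IH; last by rewrite -ltnS (leq_trans _ le_pm).
  by rewrite mulr_sumr; apply: eq_bigr => x _; rewrite -mulr_natr; ring.
have [eq_pm|ne_pm] := eqVneq p m.+1; last first.
  rewrite big1 // => i _; case: eqP => [eim|_]; last by rewrite mulr0.
  by move: ne_pm (ltn_ord i); rewrite eim eqn_leq le_pm => /= /negP.
subst p; rewrite big_ord_recr /= eqxx big1 ?add0r => [|i _]; last first.
  by rewrite ltn_eqF ?mulr0.
rewrite subSnn expr1 binSn factS natrM exprS; ring.
Qed.

(* Expanding the second power around [c = a + b + s n] turns each inner sum into
   the [m]-th finite difference of [X ^ m]. *)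
Lemma abel_binomial (K : numFieldType) (n : nat) (a b s : K) :
  \sum_(x < n.+1) (a + s * x%:R) ^+ x / x`!%:R *
     ((b + s * (n - x)%:R) ^+ (n - x) / (n - x)`!%:R) =
  \sum_(j < n.+1) s ^+ j * ((a + b + s * n%:R) ^+ (n - j) / (n - j)`!%:R).
Proof.
have fact_neq0 m : m`!%:R != 0 :> K by rewrite pnatr_eq0 -lt0n fact_gt0.
have binE m x : (x <= m)%N ->
    'C(m, x)%:R = m`!%:R / (x`!%:R * (m - x)`!%:R) :> K.
  by move=> le_xm; rewrite -(bin_fact le_xm) !natrM mulfK ?mulf_neq0.
set c := a + b + s * n%:R.
transitivity (\sum_(x < n.+1) \sum_(j < (n - x).+1)
   c ^+ j / j`!%:R * ((-1) ^+ (n - j - x) * (a + s * x%:R) ^+ (n - j) /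
                      (x`!%:R * (n - j - x)`!%:R))).
  apply: eq_bigr => x _; have le_xn : (x <= n)%N by rewrite -ltnS.
  have -> : b + s * (n - x)%:R = - (a + s * x%:R) + c.
    by rewrite natrB // /c; ring.
  rewrite (exprDn (- _)) mulr_suml mulr_sumr; apply: eq_bigr => j _.
  have le_jnx : (j <= n - x)%N by rewrite -ltnS.
  rewrite -[_ *+ 'C(_, _)]mulr_natr binE // (exprNn (_ + _)) subnAC.
  (* The exponents [x] and [n - x - j] of [a + s x] add up to [n - j], which no longer depends on
     [x]. *)
  have -> : (n - j = x + (n - x - j))%N by lia.
  by rewrite addKn exprD; field; rewrite !fact_neq0.
rewrite (sum_triangle_exchange n (fun x j =>
   c ^+ j / j`!%:R * ((-1) ^+ (n - j - x) * (a + s * x%:R) ^+ (n - j) /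
                      (x`!%:R * (n - j - x)`!%:R)))).
rewrite [RHS](reindex_inj rev_ord_inj) /=; apply: eq_bigr => j _.
rewrite subSS; have le_jn : (j <= n)%N by rewrite -ltnS.
rewrite subKn //; set m := (n - j)%N.
rewrite -mulr_sumr [RHS]mulrC; congr (_ * _).
apply: (mulIf (fact_neq0 m)); have := finite_difference a s (leqnn m).
rewrite eqxx => <-; rewrite mulr_suml; apply: eq_bigr => x _.
by rewrite binE -1?ltnS //; field; rewrite !fact_neq0.
Qed.

(** Hockey-stick identity; it collects the coefficients when [coef_prod_abel] gains a factor. *)
Lemma sum_binomial_diag (m r : nat) :
  (\sum_(j < r.+1) 'C((j + m).-1, j) = 'C(r + m, r))%N.
Proof.
elim: r => [|r IH]; first by rewrite big_ord1 !bin0.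
by rewrite big_ord_recr /= IH addSn /= binS addnC.
Qed.

(* At [m = 0] the truncated predecessor is harmless: ['C(j.-1, j)] is [1] at
   [j = 0] and [0] otherwise. *)
Lemma coef_prod_abel (K : numFieldType) (N m : nat) (a : 'I_m.+1 -> K)
    (s : K) (n : nat) : (n <= N)%N ->
  (\prod_(i < m.+1) \poly_(x < N.+1) ((a i + s * x%:R) ^+ x / x`!%:R))`_n =
  \sum_(j < n.+1) 'C((j + m).-1, j)%:R * s ^+ j *
    ((\sum_(i < m.+1) a i + s * n%:R) ^+ (n - j) / (n - j)`!%:R).
Proof.
elim: m a n => [|m IH] a n le_nN.
  rewrite !big_ord1 coef_poly ltnS le_nN big_ord_recl /= big1 ?addr0 => [|j _].
    by rewrite subn0 bin0 expr0 !mul1r.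
  by rewrite addn0 /= bin_small // !mul0r.
rewrite big_ord_recr [\sum_(i < m.+2) _]big_ord_recr /= coefM.
set A := \sum_(i < m.+1) _; set b := a ord_max.
(* [F] is the summand after the induction hypothesis, with [l] the degree it leaves over. For fixed
   [j], [abel_binomial] turns the sum over [l] into a sum of [G j h]; grouping by [j + h] then
   leaves a hockey-stick sum. *)
pose F j l := 'C((j + m).-1, j)%:R * s ^+ j *
  ((A + s * j%:R + s * l%:R) ^+ l / l`!%:R *
   ((b + s * (n - j - l)%:R) ^+ (n - j - l) / (n - j - l)`!%:R)).
pose G j h := 'C((j + m).-1, j)%:R * s ^+ (j + h) *
  ((A + b + s * n%:R) ^+ (n - (j + h)) / (n - (j + h))`!%:R).
transitivity (\sum_(i < n.+1) \sum_(j < i.+1) F j (i - j)%N).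
  apply: eq_bigr => i _; have le_in : (i <= n)%N by rewrite -ltnS.
  rewrite IH ?(leq_trans le_in) // coef_poly ltnS (leq_trans (leq_subr _ _)) //.
  rewrite mulr_suml; apply: eq_bigr => j _.
  have le_ji : (j <= i)%N by rewrite -ltnS.
  by rewrite /F -addrA -mulrDr -natrD subnKC // -subnDA subnKC // !mulrA.
rewrite (sum_triangle n F).
transitivity (\sum_(i < n.+1) \sum_(j < i.+1) G j (i - j)%N); last first.
  apply: eq_bigr => i _; rewrite addnS /= -sum_binomial_diag natr_sum.
  rewrite !mulr_suml; apply: eq_bigr => j _.
  by rewrite /G subnKC -1?ltnS.
rewrite (sum_triangle n G); apply: eq_bigr => j _.
have le_jn : (j <= n)%N by rewrite -ltnS.
rewrite /F -mulr_sumr abel_binomial mulr_sumr; apply: eq_bigr => h _.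
rewrite /G exprD subnDA natrB //.
(* The shift [s j] makes up for the shorter length [n - j], so the base is the same for all [j]. *)
have -> : A + s * j%:R + b + s * (n%:R - j%:R) = A + b + s * n%:R by ring.
by ring.
Qed.

(** By Pascal's rule, [1 - s] times the partial sum for [m.+1] is the one for [m] minus a
    nonnegative boundary term. *)
Lemma negative_binomial_partial_sum (K : realFieldType) (s : K) (m n : nat) :
  0 <= s -> s < 1 ->
  \sum_(j < n.+1) 'C((j + m).-1, j)%:R * s ^+ j <= (1 / (1 - s)) ^+ m.
Proof.
rewrite div1r => s_ge0 s_lt1; have s1 : 0 < 1 - s by rewrite subr_gt0.
elim: m n => [|m IH] n.
  rewrite big_ord_recl /= big1 ?addr0 => [|j _]; first by rewrite bin0 expr0 mulr1.
  by rewrite addn0 /= bin_small // mul0r.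
rewrite exprS -ler_pdivrMl ?invr_gt0 // invrK.
apply: le_trans (IH n); rewrite -subr_ge0.
have -> : forall k, \sum_(j < k.+1) 'C((j + m).-1, j)%:R * s ^+ j
   - (1 - s) * (\sum_(j < k.+1) 'C((j + m.+1).-1, j)%:R * s ^+ j)
   = 'C(k + m, k)%:R * s ^+ k.+1.
  elim=> [|k IHk]; first by rewrite !big_ord1 !bin0; ring.
  rewrite big_ord_recr [in X in _ - X]big_ord_recr /= mulrDr opprD addrACA IHk.
  by rewrite addnS addSn /= binS natrD !exprS; ring.
by rewrite mulr_ge0 ?exprn_ge0.
Qed.

(** Weighted AM-GM for [1] and [r], with [r ^ s] written as an exponential. *)
Lemma expR_ln_le (R : realType) (s r : R) : 0 <= s -> s <= 1 -> 0 < r ->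
  expR (s * ln r) <= 1 - s + s * r.
Proof.
move=> s_ge0 s_le1 r_gt0; set L := ln r.
(* Tangent lines of [expR] at [s L], evaluated at [0] and [L]. *)
have rE : r = expR (s * L) * expR ((1 - s) * L).
  by rewrite -expRD -mulrDl addrC subrK mul1r lnK.
have oneE : 1 = expR (s * L) * expR (- (s * L)) by rewrite expRxMexpNx_1.
have E0 := expR_gt0 (s * L).
have h1 := ler_wpM2l (ltW E0) (expR_ge1Dx (- (s * L))).
have h2 := ler_wpM2l (ltW E0) (expR_ge1Dx ((1 - s) * L)).
rewrite -oneE in h1; rewrite -rE in h2.
have s1 : 0 <= 1 - s by rewrite subr_ge0.
have := lerD (ler_wpM2l s1 h1) (ler_wpM2l s_ge0 h2); nra.
Qed.

(** Recasts a sum over multinomial outcomes as a coefficient of a product, which can be computed by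
    induction on the number of factors. *)
Lemma coef_prod_poly (K : comNzRingType) (N k n : nat) (f : 'I_k -> nat -> K) :
  (\prod_(i < k) \poly_(x < N.+1) f i x)`_n =
  \sum_(x : {ffun 'I_k -> 'I_N.+1} | (\sum_(i < k) (x i : nat) == n)%N)
    \prod_(i < k) f i (x i).
Proof.
under eq_bigr => i _ do rewrite poly_def.
rewrite bigA_distr_bigA coef_sum [RHS]big_mkcond; apply: eq_bigr => x _ /=.
under eq_bigr => i _ do rewrite -mul_polyC.
rewrite big_split /= prodrXr -rmorph_prod coefCM coefXn eq_sym.
by case: eqP; rewrite ?mulr1 ?mulr0.
Qed.

Lemma tilted_weight_le (R : realType) (n x : nat) (p s t : R) :
  (0 < n)%N -> 0 <= p -> 0 <= s -> s <= 1 -> t = s * n%:R ->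
  p ^+ x * expR (t * (if x%:R / n%:R == 0 :> R then 0
                      else x%:R / n%:R * ln (x%:R / n%:R / p))) <=
  ((1 - s) * n%:R * p + s * x%:R) ^+ x / n%:R ^+ x.
Proof.
move=> n_gt0 p_ge0 s_ge0 s_le1 ->.
have nR : 0 < n%:R :> R by rewrite ltr0n.
(* At [x = 0] the convention for [0 log 0] makes both sides [1]. *)
case: x => [|x]; first by rewrite mul0r eqxx mulr0 expR0 !expr0 divr1 mulr1.
set y := x.+1; have yR : 0 < y%:R :> R by rewrite ltr0n.
have rhs_ge0 : 0 <= (1 - s) * n%:R * p + s * y%:R.
  by rewrite addr_ge0 ?mulr_ge0 ?subr_ge0 // ltW.
rewrite gt_eqF ?divr_gt0 //.
(* If [p = 0], the quotient by [p] is a junk value, but the factor [p ^+ y] with [y > 0] kills the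
   left side. *)
have [->|p_neq0] := eqVneq p 0.
  rewrite exprS !mul0r mulr_ge0 ?invr_ge0 ?exprn_ge0 ?(ltW nR) //.
  by rewrite mulr0 add0r mulr_ge0 // ltW.
have p_gt0 : 0 < p by rewrite lt_def p_neq0.
set r := y%:R / n%:R / p; have r_gt0 : 0 < r by rewrite !divr_gt0.
(* Both sides become [y]-th powers, so only the bases need comparing. *)
have -> : s * n%:R * (y%:R / n%:R * ln r) = y%:R * (s * ln r).
  by field; rewrite gt_eqF.
rewrite expRM_natl -exprMn -expr_div_n lerXn2r ?nnegrE ?divr_ge0 ?(ltW nR) //.
  by rewrite mulr_ge0 // expR_ge0.
have -> : ((1 - s) * n%:R * p + s * y%:R) / n%:R = p * (1 - s + s * r).
  by rewrite /r; field; rewrite p_neq0 gt_eqF.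
by rewrite ler_wpM2l // expR_ln_le.
Qed.

Lemma ffact_le_expn (n j : nat) : (n ^_ j <= n ^ j)%N.
Proof.
elim: j => [|j IH]; first by rewrite ffactn0.
by rewrite ffactnSr expnSr leq_mul // leq_subr.
Qed.

Theorem theorem1p3 (R : realType) (n k : nat) (p : 'I_k -> R) (t : R) :
  (0 < n)%N -> (2 <= k)%N -> is_prob_vec p ->
  0 <= t -> t < n%:R ->
  multinomial_expect n p (fun x => expR (t * V_stat n p x))
    <= (1 / (1 - t / n%:R)) ^+ k.-1.
Proof.
move=> n_gt0; case: k p => [//|m] p _ [p_ge0 p_sum] t_ge0 t_ltn.
have nR : 0 < n%:R :> R by rewrite ltr0n.
set s := t / n%:R.
have s_ge0 : 0 <= s by rewrite divr_ge0 // ltW.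
have s_lt1 : s < 1 by rewrite ltr_pdivrMr // mul1r.
have tE : t = s * n%:R by rewrite divfK // gt_eqF.
pose a i := (1 - s) * n%:R * p i.
(* This total makes the closed form of [coef_prod_abel] collapse to powers of [n]. *)
have a_sum : \sum_i a i + s * n%:R = n%:R.
  by rewrite -mulr_sumr p_sum; ring.
apply: (@le_trans _ _ (n`!%:R / n%:R ^+ n *
  (\prod_(i < m.+1) \poly_(x < n.+1) ((a i + s * x%:R) ^+ x / x`!%:R))`_n)).
  rewrite coef_prod_poly mulr_sumr; apply: ler_sum => x /eqP x_sum.
  rewrite /multinomial_pmf /V_stat /KL mulr_sumr expR_sum -!mulrA.
  (* Since the counts sum to [n], the factor [n ^- n] splits over the categories and the bound can
     be proved factor by factor. *)
  have -> : n%:R ^- n = \prod_i n%:R ^- x i :> R.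
    by rewrite prodfV prodrXr x_sum.
  rewrite ler_wpM2l // -prodfV -!big_split /=; apply: ler_prod => i _.
  have x_fact : 0 <= ((x i)`!%:R)^-1 :> R by rewrite invr_ge0.
  rewrite !mulr_ge0 ?exprn_ge0 ?expR_ge0 //=.
  rewrite [leLHS]mulrC [leRHS]mulrCA [leRHS]mulrA ler_wpM2r //.
  by rewrite tilted_weight_le // ltW.
rewrite coef_prod_abel // a_sum mulr_sumr.
apply: le_trans (negative_binomial_partial_sum m n s_ge0 s_lt1).
apply: ler_sum => j _; have le_jn : (j <= n)%N by rewrite -ltnS.
rewrite mulrCA ler_piMr ?mulr_ge0 ?exprn_ge0 //.
have -> : n`!%:R / n%:R ^+ n * (n%:R ^+ (n - j) / (n - j)`!%:R) =
    (n ^_ j)%:R / n%:R ^+ j :> R.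
  have -> : n%:R ^+ n = n%:R ^+ (n - j) * n%:R ^+ j :> R.
    by rewrite -exprD subnK.
  rewrite -(ffact_fact le_jn) natrM.
  by field; rewrite pnatr_eq0 -lt0n fact_gt0 !expf_neq0 // gt_eqF.
by rewrite ler_pdivrMr ?exprn_gt0 // mul1r -natrX ler_nat ffact_le_expn.
Qed.
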